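(* Let $(X,\gamma_X)$ and $(Y,\gamma_Y)$ be gauge spaces. If $T:(X,\gamma_X)\to(Y,\gamma_Y)$ is a gauge isometry such that $T(0_X)=0_Y$, where $0_X$ and $0_Y$ are the origins of $X$ and $Y$, then $T$ is linear.
   Context: A gauge on a finite-dimensional real vector space $X$ is a function $\gamma:X\to\mathbb{R}$ such that $\gamma(x)\ge 0$ with equality iff $x=0$; $\gamma(\alpha x)=\alpha\gamma(x)$ for all $\alpha\ge 0$, $x\in X$; and $\gamma(x+y)\le\gamma(x)+\gamma(y)$ for all $x,y\in X$ (no symmetry $\gamma(-x)=\gamma(x)$ is assumed). A pair $(X,\gamma)$ is a gauge space; it has the (possibly non-symmetric) distance $d_X(x,z)=\gamma(z-x)$. A map $T:(X,\gamma_X)\to(Y,\gamma_Y)$ (not assumed linear) is a gauge isometry if $d_X(x,z)=d_Y(Tx,Tz)$ for all $x,z\in X$.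
   Formalization: T is additionally assumed to be onto Y; without this the claim is false: t ↦ (t,|t|) from the real line with |·| to the plane with the max norm is a gauge isometry fixing the origin that is not linear. *)

(* Defs.v *)
From HB Require Import structures.
From mathcomp Require Import all_boot all_order all_algebra.
From mathcomp Require Import reals.

Set Implicit Arguments.
Unset Strict Implicit.
Unset Printing Implicit Defensive.

Import Order.TTheory GRing.Theory Num.Theory.

Local Open Scope ring_scope.

Definition is_gauge (R : realType) (X : vectType R) (g : X -> R) : Prop :=
  [/\ forall x : X, 0 <= g x,
      forall x : X, g x = 0 <-> x = 0,
      forall (a : R) (x : X), 0 <= a -> g (a *: x) = a * g x
    & forall x y : X, g (x + y) <= g x + g y].

(* The order of the two points matters: g need not be symmetric.              *)
Definition gauge_dist (R : realType) (X : vectType R) (g : X -> R)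
    (x z : X) : R := g (z - x).

(* T need not be onto. Distance preservation and T 0 = 0 alone do not imply   *)
(* linearity: t |-> (t, |t|) from R to R^2 with the max norm satisfies both.  *)
Definition gauge_isometry (R : realType) (X Y : vectType R)
    (gX : X -> R) (gY : Y -> R) (T : X -> Y) : Prop :=
  forall x z : X, gauge_dist gX x z = gauge_dist gY (T x) (T z).

(* Main.v *)
(** Symmetrizing, [x |-> g x + g (- x)] turns gauges into norms and keeps [T]
    isometric, so the Mazur-Ulam theorem applies.  Its proof is Väisälä's: if
    [h] is a bijective isometry fixing [a] and [b], [z] is their midpoint and
    [psi] is the reflection in [z], then [psi h^-1 psi h] again fixes [a] and
    [b] and moves [z] twice as far as [h] does; since these displacements are
    bounded, [h z = z].  Applied to [psi T^-1 psi' T] this shows that [T]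
    preserves midpoints, hence is additive.  Finally [a |-> T (a x) - a T x] is
    additive, bounded on [0, 1] and zero at 1, hence bounded, hence zero. *)
Require Import Defs.
From mathcomp Require Import all_boot all_order all_algebra.
From mathcomp Require Import reals.

Set Implicit Arguments.
Unset Strict Implicit.
Unset Printing Implicit Defensive.

Import Order.TTheory GRing.Theory Num.Theory.

Local Open Scope ring_scope.

Lemma le0_of_bounded_multiples (R : realType) (d C : R) :
  (forall n : nat, d *+ n <= C) -> d <= 0.
Proof.
move=> bnd; rewrite leNgt; apply/negP => d0.
(* [0 <= C] is the bound at [n = 0]. *)
have C0 : 0 <= C / d by rewrite divr_ge0 ?(ltW d0) // -[0](mulr0n d).
have := archi_boundP C0; rewrite ltr_pdivrMr // mulrC mulr_natr => lt.
by have := lt_le_trans lt (bnd _); rewrite ltxx.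
Qed.

Definition sym_gauge (R : realType) (X : vectType R) (g : X -> R) (x : X) : R :=
  g x + g (- x).

Lemma sym_gaugeN (R : realType) (X : vectType R) (g : X -> R) (x : X) :
  sym_gauge g (- x) = sym_gauge g x.
Proof. by rewrite /sym_gauge opprK addrC. Qed.

Lemma sym_gauge_is_gauge (R : realType) (X : vectType R) (g : X -> R) :
  is_gauge g -> is_gauge (sym_gauge g).
Proof.
case=> g0 gE gZ gD; split=> [x|x|a x a0|x y].
- by rewrite addr_ge0.
- split=> [/eqP|->]; first by rewrite paddr_eq0 // => /andP[/eqP/gE].
  by rewrite /sym_gauge oppr0; have /gE -> : (0 : X) = 0 by []; rewrite addr0.
- by rewrite /sym_gauge -scalerN !gZ // mulrDr.
- by rewrite /sym_gauge opprD addrACA lerD.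
Qed.

Lemma sym_gauge_isometry (R : realType) (X Y : vectType R)
    (gX : X -> R) (gY : Y -> R) (T : X -> Y) :
  gauge_isometry gX gY T ->
  gauge_isometry (sym_gauge gX) (sym_gauge gY) T.
Proof.
move=> hT x z; rewrite /gauge_dist /sym_gauge !opprB.
by congr (_ + _); apply: hT.
Qed.

Lemma gauge_isometry_inj (R : realType) (X Y : vectType R)
    (gX : X -> R) (gY : Y -> R) (T : X -> Y) :
  is_gauge gX -> is_gauge gY -> gauge_isometry gX gY T -> injective T.
Proof.
case=> _ EX _ _ [_ EY _ _] hT x z eT.
have := hT x z; rewrite /gauge_dist eT subrr.
have /EY -> : (0 : Y) = 0 by [].
by move=> /EX/eqP; rewrite subr_eq0 => /eqP.
Qed.

Lemma gauge_isometry_can (R : realType) (X Y : vectType R)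
    (gX : X -> R) (gY : Y -> R) (T : X -> Y) (T' : Y -> X) :
  cancel T' T -> gauge_isometry gX gY T -> gauge_isometry gY gX T'.
Proof. by move=> K hT x z; rewrite hT !K. Qed.

Lemma gauge_isometry_comp (R : realType) (X Y Z : vectType R)
    (gX : X -> R) (gY : Y -> R) (gZ : Z -> R) (S : Y -> Z) (T : X -> Y) :
  gauge_isometry gY gZ S -> gauge_isometry gX gY T ->
  gauge_isometry gX gZ (S \o T).
Proof. by move=> hS hT x z; rewrite hT hS. Qed.

Lemma reflection_isometry (R : realType) (X : vectType R) (N : X -> R) (s : X) :
  (forall x, N (- x) = N x) -> gauge_isometry N N (fun x => s - x).
Proof.
move=> NN x z; rewrite /gauge_dist -NN; congr N.
by rewrite opprB [RHS]addrC opprB addrA subrK addrC.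
Qed.

Lemma reflectionK (V : zmodType) (s : V) : involutive (fun x => s - x).
Proof. by move=> x; rewrite subKr. Qed.

(** Reflection in the centre [2^-1 *: s] moves a point by twice its offset from that centre. This
    yields both the factor 2 in the doubling argument and the fact that the centre is the only fixed
    point. *)
Lemma half_sum_reflection (R : realType) (X : vectType R) (s x : X) :
  s - x - x = 2 *: (2^-1 *: s - x).
Proof.
by rewrite scalerBr scalerA divff ?pnatr_eq0 // scale1r scaler_nat mulr2n opprD
  addrA.
Qed.

Lemma isometry_fixes_midpoint (R : realType) (X : vectType R) (N : X -> R)
    (h h' : X -> X) (a b : X) :
  is_gauge N -> (forall x, N (- x) = N x) ->
  cancel h h' -> cancel h' h -> gauge_isometry N N h ->
  h a = a -> h b = b -> h (2^-1 *: (a + b)) = 2^-1 *: (a + b).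
Proof.
move=> gN NN; set s := a + b; set z := 2^-1 *: s.
have [N0 NE NZ ND] := gN.
pose psi x := s - x.
have psiK : involutive psi by exact: reflectionK.
have psiI : gauge_isometry N N psi by exact: reflection_isometry.
have psia : psi a = b by rewrite /psi /s addrC addKr.
have psib : psi b = a by rewrite /psi /s addrK.
have psiz : psi z = z.
  by apply/eqP; rewrite -subr_eq0 /psi half_sum_reflection subrr scaler0.
(* The bound is uniform in [h], since the induction replaces [h] by another isometry fixing [a] and
   [b]. For [k = 0] it is the triangle inequality through [a], as [h] keeps the distance from [z] to
   [a]. *)
have bnd k : forall h h' : X -> X, cancel h h' -> cancel h' h ->
    gauge_isometry N N h -> h a = a -> h b = b ->
    gauge_dist N (h z) z * 2 ^+ k <= gauge_dist N a z + gauge_dist N a z.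
  elim: k => [|k IHk] {}h {}h' hK h'K hI ha hb.
    have e : N (a - h z) = N (z - a).
      by rewrite -{1}ha -/(gauge_dist N _ _) -hI /gauge_dist -NN opprB.
    rewrite expr0 mulr1 /gauge_dist -{1}e.
    have -> : z - h z = (a - h z) + (z - a) by rewrite [RHS]addrC addrA subrK.
    exact: ND.
  have h'a : h' a = a by rewrite -{1}ha hK.
  have h'b : h' b = b by rewrite -{1}hb hK.
  have h'I := gauge_isometry_can h'K hI.
  (* Stripping off [psi], which fixes [z], and then [h'] leaves the distance from [psi (h z)] to
     [h z], twice that from [h z] to [z]. *)
  have -> : gauge_dist N (h z) z * 2 ^+ k.+1 =
            gauge_dist N (psi (h' (psi (h z)))) z * 2 ^+ k.
    rewrite -[X in gauge_dist N (psi _) X]psiz -psiI [in RHS]hI h'K /gauge_dist.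
    rewrite exprS mulrA -[in RHS]NN opprB.
    by rewrite half_sum_reflection NZ // [_ * 2]mulrC.
  apply: (IHk (psi \o (h' \o (psi \o h))) (h' \o (psi \o (h \o psi)))).
  - by move=> x /=; rewrite psiK h'K psiK hK.
  - by move=> x /=; rewrite h'K psiK hK psiK.
  - by do ![apply: gauge_isometry_comp => //].
  - by rewrite /= ha psia h'b psib.
  - by rewrite /= hb psib h'a psia.
move=> hK h'K hI ha hb; apply/esym/eqP; rewrite -subr_eq0; apply/eqP/NE/eqP.
rewrite eq_le N0 andbT.
apply: (@le0_of_bounded_multiples _ _ (gauge_dist N a z + gauge_dist N a z)).
move=> k; apply: le_trans (bnd k h h' hK h'K hI ha hb).
(* [k < 2 ^ k] turns the exponential bound into one on multiples. *)
by rewrite -[_ *+ k]mulr_natr ler_wpM2l // -natrX ler_nat ltnW // ltn_expl.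
Qed.

Lemma isometry_midpoint (R : realType) (X Y : vectType R)
    (NX : X -> R) (NY : Y -> R) (T : X -> Y) (T' : Y -> X) (a b : X) :
  is_gauge NX -> (forall x, NX (- x) = NX x) -> (forall y, NY (- y) = NY y) ->
  cancel T T' -> cancel T' T -> gauge_isometry NX NY T ->
  T (2^-1 *: (a + b)) = 2^-1 *: (T a + T b).
Proof.
move=> gX NNX NNY TK T'K TI; set z := 2^-1 *: _.
pose psi x := a + b - x; pose psi' y := T a + T b - y.
have psiK : involutive psi by exact: reflectionK.
have psi'K : involutive psi' by exact: reflectionK.
have psiI : gauge_isometry NX NX psi by exact: reflection_isometry.
have psi'I : gauge_isometry NY NY psi' by exact: reflection_isometry.
have T'I := gauge_isometry_can T'K TI.
have fz : psi (T' (psi' (T z))) = z.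
  apply: (@isometry_fixes_midpoint _ _ NX
    (psi \o (T' \o (psi' \o T))) (T' \o (psi' \o (T \o psi)))) => //.
  - by move=> x /=; rewrite psiK T'K psi'K TK.
  - by move=> x /=; rewrite T'K psi'K TK psiK.
  - apply: gauge_isometry_comp psiI _; apply: gauge_isometry_comp T'I _.
    exact: gauge_isometry_comp psi'I TI.
  - by rewrite /= /psi' [T a + _]addrC addrK TK /psi addrK.
  - by rewrite /= /psi' addrK TK /psi addrC addKr.
have psiz : psi z = z.
  by apply/eqP; rewrite -subr_eq0 /psi half_sum_reflection subrr scaler0.
(* By [fz] and [psiz], [T'] sends [psi' (T z)] to [z], so [T z] is fixed by [psi'] and must be its
   centre. *)
have /eqP : psi' (T z) - T z = 0.
  by rewrite -{2}psiz -{2}fz psiK T'K subrr.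
rewrite /psi' half_sum_reflection scaler_eq0 pnatr_eq0 /= subr_eq0.
by move/eqP.
Qed.

(** The midpoint of [2 *: u] and 0 shows that [T] commutes with doubling; then [x + y] is the
    midpoint of [2 *: x] and [2 *: y]. *)
Lemma additive_of_midpoint (R : realType) (X Y : vectType R) (T : X -> Y) :
  T 0 = 0 ->
  (forall a b, T (2^-1 *: (a + b)) = 2^-1 *: (T a + T b)) ->
  {morph T : x y / x + y}.
Proof.
move=> T0 mid x y.
have n2 : (2 : R) != 0 by rewrite pnatr_eq0.
have dbl u : T (2 *: u) = 2 *: T u.
  have := mid (2 *: u) 0.
  rewrite addr0 T0 addr0 scalerA mulVf // scale1r => ->.
  by rewrite scalerA divff // scale1r.
have := mid (2 *: x) (2 *: y).
rewrite -scalerDr scalerA mulVf // scale1r => ->.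
by rewrite !dbl -scalerDr scalerA mulVf // scale1r.
Qed.

Lemma additive_isometry_homogeneous (R : realType) (X Y : vectType R)
    (NX : X -> R) (NY : Y -> R) (T : X -> Y) (a : R) (x : X) :
  is_gauge NX -> is_gauge NY -> (forall y, NY (- y) = NY y) ->
  gauge_isometry NX NY T -> {morph T : x y / x + y} ->
  T (a *: x) = a *: T x.
Proof.
move=> [NX0 NXE NXZ NXD] [NY0 NYE NYZ NYD] NN TI TD.
have T0 : T 0 = 0 by apply: (addrI (T 0)); rewrite -TD !addr0.
have TN u : NY (T u) = NX u.
  by have := TI 0 u; rewrite /gauge_dist T0 !subr0 => ->.
pose f (c : R) := T (c *: x) - c *: T x.
have fD c d : f (c + d) = f c + f d.
  by rewrite /f !scalerDl TD opprD addrACA.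
have f0 : f 0 = 0 by rewrite /f !scale0r T0 subrr.
have f1 : f 1 = 0 by rewrite /f !scale1r subrr.
have fMn c n : f (c *+ n) = f c *+ n.
  by elim: n => [|n IHn]; rewrite ?mulr0n // !mulrS fD IHn.
have fN c : f (- c) = - f c.
  by apply/eqP; rewrite -subr_eq0 opprK -fD addNr f0.
have fint (m : int) : f m%:~R = 0.
  by case: m => m; rewrite ?NegzE ?mulrNz ?fN fMn f1 mul0rn ?oppr0.
(* As [f] vanishes on integers, [c] may be replaced by its fractional part [r]; both terms of [f r]
   then have size [r * NX x], with [r <= 1]. *)
have fb c : NY (f c) <= NX x + NX x.
  have /andP[lo hi] : ((Num.floor c)%:~R <= c < (Num.floor c + 1)%:~R).
    exact: Num.Theory.floor_itv.
  have -> : f c = f (c - (Num.floor c)%:~R) by rewrite fD fN fint subr0.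
  move: lo hi; rewrite -subr_ge0 intrD -ltrBlDl.
  move: (c - _) => r r0 /ltW r1.
  apply: le_trans (NYD _ _) _; rewrite NN NYZ // !TN NXZ //.
  by rewrite lerD // ler_piMl.
apply/eqP; rewrite -subr_eq0; apply/eqP/NYE/eqP.
rewrite eq_le NY0 andbT.
apply: (@le0_of_bounded_multiples _ _ (NX x + NX x)) => n.
have := fb (a *+ n).
by rewrite fMn -scaler_nat NYZ // mulr_natl.
Qed.

Theorem theorem2p1 (R : realType) (X Y : vectType R)
    (gX : X -> R) (gY : Y -> R)
    (hX : is_gauge gX) (hY : is_gauge gY)
    (T : X -> Y)
    (hT : gauge_isometry gX gY T)
    (hsurj : forall y : Y, exists x : X, T x = y)
    (hT0 : T 0 = 0) :
  linear T.
Proof.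
(* Stated with boolean equality so that [xchoose] can select preimages; injectivity makes this right
   inverse two-sided. *)
have ex y : exists x, T x == y by have [x <-] := hsurj y; exists x.
pose T' y := xchoose (ex y).
have T'K : cancel T' T by move=> y; apply/eqP/(xchooseP (ex y)).
have TK : cancel T T' by apply: inj_can_sym T'K (gauge_isometry_inj hX hY hT).
have sT := sym_gauge_isometry hT.
have sX := sym_gauge_is_gauge hX.
have TD : {morph T : x y / x + y}.
  apply: additive_of_midpoint => // a b.
  exact: isometry_midpoint sX (sym_gaugeN gX) (sym_gaugeN gY) TK T'K sT.
move=> a x y; rewrite TD; congr (_ + _).
apply: additive_isometry_homogeneous sX _ (sym_gaugeN gY) sT TD.
exact: sym_gauge_is_gauge.
Qed.
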